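(* Let $T_1=D_1$, $T_j=D_j-L_{j-1}T_{j-1}^{-1}U_{j-1}$ for $j=2,\dots,J$ be the Schur complements of the block LU factorization of the block tridiagonal system described in the context, and suppose that all $T_j$, $j=1,\dots,J$, are invertible. Then the block LU solve is equivalent to the double sweep optimized Schwarz method (DOSM, matrix level) with a non-overlapping decomposition, zero initial guess, and $$Q_j^l=I,\quad P_j^l=A_{l_j}^{\mathrm{ext}}-A[l_j,X_j]A[X_j,X_j]^{-1}A[X_j,l_j],\quad Q_j^r=0,\quad P_j^r=I .$$ That is, the iterates of the two algorithms satisfy $\mathfrak v_j=\big[\mathbf u_j^{(1/2)}[l_j];\ \mathbf u_j^{(1/2)}[\Theta_j]\big]$ and $\mathfrak u_j=\big[\mathbf u_j^{(1)}[l_j];\ \mathbf u_j^{(1)}[\Theta_j]\big]$ for $j=1,\dots,J$, with the convention $\mathbf u_J^{(1/2)}:=\mathbf u_J^{(1)}$ (the last subdomain is solved only once), and with the non-existent component $l_1$ removed for $j=1$.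
   Context: For index sets $X,Y$, $A[X,Y]$ is the submatrix with rows $X$ and columns $Y$, and $\mathbf v[X]$ is the restriction of $\mathbf v$ to $X$; $[\mathbf a;\mathbf b]$ denotes vertical concatenation. Index sets (non-overlapping decomposition). The global index set is the disjoint union of nonempty sets $\Theta_1,V_1,\Theta_2,\dots,V_{J-1},\Theta_J$, where $\Theta_j$ are the interior unknowns of subdomain $j$ and $V_j$ the unknowns on the interface between subdomains $j$ and $j+1$; the square matrix $A$ is block tridiagonal for this ordering. Subdomain $j$ has unknowns $W_j=V_{j-1}\cup\Theta_j\cup V_j$, left interface $l_j:=V_{j-1}$, right interface $r_j:=V_j$. Set $X_j:=\Theta_1\cup V_1\cup\dots\cup V_{j-2}\cup\Theta_{j-1}$. Sets with out-of-range index ($l_1$, $r_J$) are empty and the corresponding rows/columns are deleted. $A[l_j,l_j]=A_{l_j}^{\mathrm{int}}+A_{l_j}^{\mathrm{ext}}$ and $A[r_j,r_j]=A_{r_j}^{\mathrm{int}}+A_{r_j}^{\mathrm{ext}}$ are given splittings into contributions from the side of subdomain $j$ (int) and from the other side (ext). Block LU solve. Let $B_1=\Theta_1$, $B_j=V_{j-1}\cup\Theta_j$ for $j\ge2$; $D_j=A[B_j,B_j]$, $L_j=A[B_{j+1},B_j]$, $U_j=A[B_j,B_{j+1}]$, $\mathfrak f_j=\mathbf f[B_j]$, so that $A\mathbf u=\mathbf f$ is block tridiagonal with diagonal blocks $D_j$, subdiagonal blocks $L_j$, superdiagonal blocks $U_j$. Forward sweep: $T_1\mathfrak v_1=\mathfrak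 f_1$, $T_j\mathfrak v_j=\mathfrak f_j-L_{j-1}\mathfrak v_{j-1}$ for $j=2,\dots,J$. Backward sweep: $\mathfrak u_J=\mathfrak v_J$, $T_j\mathfrak u_j=T_j\mathfrak v_j-U_j\mathfrak u_{j+1}$ for $j=J-1,\dots,1$. DOSM (matrix level). Given $\{\mathbf u_j^{(n-1)}\in\mathbb C^{W_j}\}_{j=1}^J$ (zero for $n=1$), the forward sweep solves successively for $j=1,\dots,J-1$ for $\mathbf u_j=\mathbf u_j^{(n-1/2)}\in\mathbb C^{W_j}$, with $\mathbf a=\mathbf u_{j-1}^{(n-1/2)}$ and $\mathbf b=\mathbf u_{j+1}^{(n-1)}$: $$(Q_j^lA_{l_j}^{\mathrm{int}}+P_j^l)\mathbf u_j[l_j]+Q_j^lA[l_j,\Theta_j]\mathbf u_j[\Theta_j]=Q_j^l\big(\mathbf f[l_j]-A[l_j,\Theta_{j-1}]\mathbf a[\Theta_{j-1}]\big)+(P_j^l-Q_j^lA_{l_j}^{\mathrm{ext}})\mathbf a[l_j],$$ $$A[\Theta_j,W_j]\mathbf u_j=\mathbf f[\Theta_j],$$ $$Q_j^rA[r_j,\Theta_j]\mathbf u_j[\Theta_j]+(Q_j^rA_{r_j}^{\mathrm{int}}+P_j^r)\mathbf u_j[r_j]=Q_j^r\big(\mathbf f[r_j]-A[r_j,\Theta_{j+1}]\mathbf b[\Theta_{j+1}]\big)+(P_j^r-Q_j^rA_{r_j}^{\mathrm{ext}})\mathbf b[r_j].$$ The backward sweep solves successively for $j=J,\dots,1$ the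 same system for $\mathbf u_j=\mathbf u_j^{(n)}$ with $\mathbf a=\mathbf u_{j-1}^{(n-1/2)}$ and $\mathbf b=\mathbf u_{j+1}^{(n)}$. *)

(* Defs.v *)
From mathcomp Require Import all_boot all_order all_algebra.
From mathcomp Require Import reals complex.

Set Implicit Arguments.
Unset Strict Implicit.
Unset Printing Implicit Defensive.

Import GRing.Theory.
Local Open Scope ring_scope.

Section IndexedSubmatrices.
Variables (F : fieldType) (n : nat).
Implicit Types X Y : {set 'I_n}.

(* C^X is 'cV_#|X| and C^(X x Y) is 'M_(#|X|, #|Y|): the rows and columns are
   listed in the order of enum X and enum Y, i.e. increasingly in 'I_n. *)

(* A[X, Y] *)
Definition mxres (A : 'M[F]_n) X Y : 'M[F]_(#|X|, #|Y|) :=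
  mxsub enum_val enum_val A.

(* f[X] for a global vector f *)
Definition cvres (f : 'cV[F]_n) X : 'cV[F]_#|X| := rowsub enum_val f.

(* w[X] for w in C^Y with X \subset Y. In general the entry of index x is w x
   when x \in Y and 0 otherwise, so for Y \subset X this is the extension of w
   by zero. *)
Definition restr Y X (w : 'cV[F]_#|Y|) : 'cV[F]_#|X| := mxres 1%:M X Y *m w.

(* [a; b], for disjoint X and Y *)
Definition vconcat X Y (a : 'cV[F]_#|X|) (b : 'cV[F]_#|Y|) :
  'cV[F]_#|X :|: Y| := restr (X :|: Y) a + restr (X :|: Y) b.

End IndexedSubmatrices.

(* Theta_1, V_1, Theta_2, ..., V_(J-1), Theta_J at the positions 1, ..., 2J-1 *)
Definition block_seq n (Theta V : nat -> {set 'I_n}) (k : nat) : {set 'I_n} :=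
  if odd k then Theta k.+1./2 else V k./2.

(* Subdomains are numbered from 1 to J, and sets with an out-of-range index are
   empty; the rows and columns they index then have dimension 0. *)
Record decomposition (n J : nat) := Decomposition {
  Theta : nat -> {set 'I_n};
  V : nat -> {set 'I_n};
  Theta_neq0 : forall j, (1 <= j <= J)%N -> Theta j != set0;
  V_neq0 : forall j, (1 <= j < J)%N -> V j != set0;
  Theta_out : forall j, ~~ (1 <= j <= J)%N -> Theta j = set0;
  V_out : forall j, ~~ (1 <= j < J)%N -> V j = set0;
  block_disjoint : forall p q : nat, p != q ->
    [disjoint block_seq Theta V p & block_seq Theta V q];
  block_cover : \bigcup_(1 <= k < J.*2) block_seq Theta V k = [set: 'I_n]
}.

Section Algorithms.
Variables (F : fieldType) (n J : nat) (d : decomposition n J).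
Variables (A : 'M[F]_n) (f : 'cV[F]_n).

Definition lset (j : nat) : {set 'I_n} := V d j.-1.
Definition rset (j : nat) : {set 'I_n} := V d j.
Definition Wset (j : nat) : {set 'I_n} := lset j :|: Theta d j :|: rset j.
Definition Bset (j : nat) : {set 'I_n} := lset j :|: Theta d j.
Definition Xset (j : nat) : {set 'I_n} :=
  (\bigcup_(1 <= i < j) Theta d i) :|: (\bigcup_(1 <= i < j.-1) V d i).

Definition block_tridiagonal : Prop :=
  forall p q : nat, (p.+1 < q)%N || (q.+1 < p)%N ->
  mxres A (block_seq (Theta d) (V d) p) (block_seq (Theta d) (V d) q) = 0.

Definition Dblk (j : nat) := mxres A (Bset j) (Bset j).
Definition Lblk (j : nat) := mxres A (Bset j.+1) (Bset j).
Definition Ublk (j : nat) := mxres A (Bset j) (Bset j.+1).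

Definition schur_complements (T : forall j, 'M[F]_#|Bset j|) : Prop :=
  T 1%N = Dblk 1 /\
  forall j, (1 <= j < J)%N ->
    T j.+1 = Dblk j.+1 - Lblk j *m invmx (T j) *m Ublk j.

(* v and u are the families produced by the forward and backward sweeps. *)
Definition block_LU_solve (T : forall j, 'M[F]_#|Bset j|)
    (v u : forall j, 'cV[F]_#|Bset j|) : Prop :=
  [/\ T 1%N *m v 1%N = cvres f (Bset 1),
      forall j, (1 <= j < J)%N ->
        T j.+1 *m v j.+1 = cvres f (Bset j.+1) - Lblk j *m v j,
      u J = v J
    & forall j, (1 <= j < J)%N ->
        T j *m u j = T j *m v j - Ublk j *m u j.+1].

Variables (Aint_l Aext_l Ql Pl : forall j, 'M[F]_#|lset j|).
Variables (Aint_r Aext_r Qr Pr : forall j, 'M[F]_#|rset j|).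

Definition interface_splitting : Prop :=
  forall j, (1 <= j <= J)%N ->
    mxres A (lset j) (lset j) = Aint_l j + Aext_l j /\
    mxres A (rset j) (rset j) = Aint_r j + Aext_r j.

(* The system for w = u_j, with data a = u_(j-1) and b = u_(j+1). *)
Definition subdomain_solve (j : nat) (a : 'cV[F]_#|Wset j.-1|)
    (b : 'cV[F]_#|Wset j.+1|) (w : 'cV[F]_#|Wset j|) : Prop :=
  [/\ (Ql j *m Aint_l j + Pl j) *m restr (lset j) w
        + Ql j *m mxres A (lset j) (Theta d j) *m restr (Theta d j) w
      = Ql j *m (cvres f (lset j)
                 - mxres A (lset j) (Theta d j.-1) *m restr (Theta d j.-1) a)
        + (Pl j - Ql j *m Aext_l j) *m restr (lset j) a,
      mxres A (Theta d j) (Wset j) *m w = cvres f (Theta d j)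
    & Qr j *m mxres A (rset j) (Theta d j) *m restr (Theta d j) w
        + (Qr j *m Aint_r j + Pr j) *m restr (rset j) w
      = Qr j *m (cvres f (rset j)
                 - mxres A (rset j) (Theta d j.+1) *m restr (Theta d j.+1) b)
        + (Pr j - Qr j *m Aext_r j) *m restr (rset j) b].

(* One double sweep: u0 = u^(n-1), uh = u^(n-1/2), u1 = u^(n). The forward sweep
   stops at J-1, so it leaves uh J unconstrained. *)
Definition double_sweep (u0 uh u1 : forall j, 'cV[F]_#|Wset j|) : Prop :=
  (forall j, (1 <= j < J)%N -> subdomain_solve (uh j.-1) (u0 j.+1) (uh j)) /\
  (forall j, (1 <= j <= J)%N -> subdomain_solve (uh j.-1) (u1 j.+1) (u1 j)).

End Algorithms.

(* Main.v *)
Require Import Defs.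
From mathcomp Require Import all_boot all_order all_algebra.
From mathcomp Require Import reals complex.

(* T_j is the Schur complement obtained by eliminating X_j from A on X_j + B_j.
   Since Theta_j is not coupled to X_j, its correction to A[B_j, B_j] only
   touches the l_j-block, where it is Pl_j - Aext_l_j.  Hence a DOSM subdomain
   problem with Dirichlet data on r_j is a system with matrix T_j for w[B_j],
   whose right-hand side carries the data of the neighbours.  In the forward
   sweep the zero initial guess gives u_(j-1)[r_(j-1)] = 0, that is, zero on l_j,
   so the left data reduce to L_(j-1) v_(j-1).  In the backward sweep the left
   data are those of the forward sweep, which account for T_j v_j, and the right
   data amount to U_j u_(j+1). *)

Set Implicit Arguments.
Unset Strict Implicit.
Unset Printing Implicit Defensive.

Import GRing.Theory.
Local Open Scope ring_scope.

(** * Index sets, extension by zero, and block elimination *)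

Section Embeddings.
Variables (F : fieldType) (n : nat).
Implicit Types (X Y Z B : {set 'I_n}) (A M N : 'M[F]_n) (x y : 'cV[F]_n).

(* emb X is extension by zero from F^X to F^n; it turns all submatrices and
   restrictions into products of global matrices. *)
Definition emb X : 'M[F]_(n, #|X|) := colsub enum_val 1%:M.
Definition prj X : 'M[F]_n := \matrix_(i, j) ((i == j) && (i \in X))%:R.

Lemma tr_emb X : (emb X)^T = rowsub enum_val 1%:M.
Proof. by apply/matrixP=> i j; rewrite !mxE eq_sym. Qed.

Lemma tr_emb_mul m X (C : 'M[F]_(n, m)) : (emb X)^T *m C = rowsub enum_val C.
Proof. by rewrite tr_emb mul_rowsub_mx mul1mx. Qed.

Lemma cvres_emb X x : cvres x X = (emb X)^T *m x.
Proof. by rewrite tr_emb_mul. Qed.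

Lemma mxres_emb A X Y : mxres A X Y = (emb X)^T *m A *m emb Y.
Proof.
rewrite tr_emb_mul /emb mulmx_colsub mulmx1.
by apply/matrixP=> i j; rewrite !mxE.
Qed.

Lemma restr_emb X Y (w : 'cV[F]_#|Y|) : restr X w = (emb X)^T *m (emb Y *m w).
Proof. by rewrite /restr mxres_emb mulmx1 mulmxA. Qed.

Lemma emb_tr_emb X : (emb X)^T *m emb X = 1%:M.
Proof.
rewrite tr_emb_mul; apply/matrixP=> i j.
by rewrite !mxE (inj_eq enum_val_inj).
Qed.

Lemma prj_emb_tr X : prj X = emb X *m (emb X)^T.
Proof.
apply/matrixP=> i j; rewrite !mxE.
under [RHS]eq_bigr => k _ do rewrite !mxE -natrM mulnb.
rewrite -(big_enum_val (fun k => ((i == k) && (j == k))%:R)) /=.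
case: (boolP (i \in X)) => iX; last first.
  rewrite andbF big1 // => k kX; case: eqP => // eik.
  by rewrite eik kX in iX.
rewrite andbT (bigD1 i) //= eqxx eq_sym big1 ?addr0 // => k /andP[_ kNi].
by rewrite eq_sym (negPf kNi).
Qed.

Lemma prj_mulE m X (C : 'M[F]_(n, m)) i j :
  (prj X *m C) i j = (i \in X)%:R * C i j.
Proof.
rewrite mxE (bigD1 i) //= mxE eqxx big1 ?addr0 // => k kNi.
by rewrite mxE eq_sym (negPf kNi) /= mul0r.
Qed.

Lemma prj_emb X : prj X *m emb X = emb X.
Proof. by rewrite prj_emb_tr -mulmxA emb_tr_emb mulmx1. Qed.

Lemma tr_emb_prj X : (emb X)^T *m prj X = (emb X)^T.
Proof. by rewrite prj_emb_tr mulmxA emb_tr_emb mul1mx. Qed.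

Lemma prj_id X : prj X *m prj X = prj X.
Proof. by rewrite {2}prj_emb_tr mulmxA prj_emb -prj_emb_tr. Qed.

Lemma prjU X Y : [disjoint X & Y] -> prj (X :|: Y) = prj X + prj Y.
Proof.
move=> dXY; apply/matrixP=> i j; rewrite !mxE inE.
case: (i == j); rewrite ?addr0 //=.
case: (boolP (i \in X)) => iX /=; last by rewrite add0r.
by rewrite (disjointFr dXY iX) addr0.
Qed.

Lemma prj_sub X Y : X \subset Y -> prj Y *m prj X = prj X.
Proof.
move=> /subsetP sXY; apply/matrixP=> i j; rewrite prj_mulE mxE.
case: (boolP (i \in X)) => iX; last by rewrite andbF mulr0.
by rewrite (sXY i iX) mul1r.
Qed.

Lemma prj_disj X Y : [disjoint X & Y] -> prj X *m prj Y = 0.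
Proof.
move=> dXY; apply/matrixP=> i j; rewrite prj_mulE !mxE.
case: (boolP (i \in X)) => iX; last by rewrite mul0r.
by rewrite (disjointFr dXY iX) andbF mulr0.
Qed.

Lemma cvresP X x y :
  reflect {in X, forall i, x i 0 = y i 0} (cvres x X == cvres y X).
Proof.
apply: (iffP eqP) => [exy i iX | exy].
  have /matrixP/(_ (enum_rank_in iX i) 0) := exy.
  by rewrite !mxE !enum_rankK_in.
by apply/matrixP=> i j; rewrite !mxE ord1 exy ?enum_valP.
Qed.

Lemma cvresU X Y x y : cvres x (X :|: Y) = cvres y (X :|: Y) <->
  cvres x X = cvres y X /\ cvres x Y = cvres y Y.
Proof.
split=> [/eqP/cvresP exy | [/eqP/cvresP eX /eqP/cvresP eY]].
  by split; apply/eqP/cvresP=> i iX; rewrite exy // inE iX ?orbT.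
by apply/eqP/cvresP=> i; rewrite inE => /orP[/eX | /eY].
Qed.

Lemma mxres0P A X Y :
  reflect {in X & Y, forall i j, A i j = 0} (mxres A X Y == 0).
Proof.
apply: (iffP eqP) => [A0 i j iX jY | A0].
  have /matrixP/(_ (enum_rank_in iX i) (enum_rank_in jY j)) := A0.
  by rewrite !mxE !enum_rankK_in.
by apply/matrixP=> i j; rewrite !mxE A0 ?enum_valP.
Qed.

Lemma mxres0_mul m A X Y (C : 'M[F]_(n, m)) : mxres A X Y = 0 ->
  (emb X)^T *m (A *m (prj Y *m C)) = 0.
Proof. by move=> A0; rewrite prj_emb_tr !mulmxA -mxres_emb A0 !mul0mx. Qed.

(* A[X, X]^-1 extended by zero.  It is locked because rewriting with mulmxA
   would otherwise see through the product. *)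
Definition pinv A X : 'M[F]_n :=
  locked (emb X *m invmx (mxres A X X) *m (emb X)^T).

Lemma pinvE A X : pinv A X = emb X *m invmx (mxres A X X) *m (emb X)^T.
Proof. by rewrite /pinv -lock. Qed.

Lemma prj_pinv A X : prj X *m pinv A X = pinv A X.
Proof. by rewrite pinvE !mulmxA prj_emb. Qed.

Lemma pinv_prj A X : pinv A X *m prj X = pinv A X.
Proof. by rewrite pinvE -!mulmxA tr_emb_prj. Qed.

Lemma prj_mul_pinv A X : mxres A X X \in unitmx -> prj X *m A *m pinv A X = prj X.
Proof.
move=> uA; rewrite prj_emb_tr pinvE !mulmxA -2!(mulmxA (emb X)) -mxres_emb.
by rewrite mulmxK // -mulmxA.
Qed.

(** Compressed to [X], the candidate [N] is a right inverse of a square matrix, hence its inverse. A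
    block is thus shown invertible by exhibiting an inverse. *)
Lemma pinv_unique A X N :
  prj X *m N = N -> N *m prj X = N -> prj X *m A *m N = prj X ->
  mxres A X X \in unitmx /\ pinv A X = N.
Proof.
move=> ePN eNP eAN.
have AN1 : mxres A X X *m ((emb X)^T *m N *m emb X) = 1%:M.
  rewrite mxres_emb !mulmxA -(mulmxA _ (emb X)) -prj_emb_tr -(mulmxA _ _ N) ePN.
  rewrite -(tr_emb_prj X) -(mulmxA _ _ A) -(mulmxA _ _ N) eAN tr_emb_prj.
  exact: emb_tr_emb.
have [uA _] := mulmx1_unit AN1; split=> //.
have -> : pinv A X = emb X *m ((emb X)^T *m N *m emb X) *m (emb X)^T.
  by rewrite pinvE -[X in _ *m X *m _]mulmx1 -AN1 mulKmx.
by rewrite !mulmxA -prj_emb_tr ePN -mulmxA -prj_emb_tr eNP.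
Qed.

(* Block elimination: with M = A[Y,Y]^-1 and t = T^-1 extended by zero, the
   inverse of the larger block is M + (1 - M A) t (1 - A M). *)
Lemma schur_block_elimination A Y B (T : 'M[F]_#|B|) :
  [disjoint Y & B] -> mxres A Y Y \in unitmx ->
  T = mxres A B B - (emb B)^T *m A *m pinv A Y *m A *m emb B ->
  T \in unitmx ->
  mxres A (Y :|: B) (Y :|: B) \in unitmx /\
  prj B *m pinv A (Y :|: B) *m prj B = emb B *m invmx T *m (emb B)^T.
Proof.
move=> dYB uA eT uT; set M := pinv A Y in eT *.
set t := emb B *m invmx T *m (emb B)^T.
have PMl : prj Y *m M = M := prj_pinv A Y.
have PMr : M *m prj Y = M := pinv_prj A Y.
have PtB : prj B *m t = t by rewrite /t !mulmxA prj_emb.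
have tPB : t *m prj B = t by rewrite /t -!mulmxA tr_emb_prj.
have dBY : [disjoint B & Y] by rewrite disjoint_sym.
have PYB : prj Y *m prj B = 0 := prj_disj dYB.
have PBY : prj B *m prj Y = 0 := prj_disj dBY.
have PBM : prj B *m M = 0 by rewrite -PMl mulmxA PBY mul0mx.
have MPB : M *m prj B = 0 by rewrite -PMr -mulmxA PYB mulmx0.
have PAM : prj Y *m A *m M = prj Y := prj_mul_pinv uA.
clearbody M.
(* This is [T T^-1 = 1] carried over to global matrices. *)
have St : prj B *m A *m t - prj B *m A *m M *m A *m t = prj B.
  rewrite /t !mulmxA -2!mulmxBl.
  have -> : prj B *m A *m emb B - prj B *m A *m M *m A *m emb B = emb B *m T.
    by rewrite eT mulmxBr mxres_emb prj_emb_tr !mulmxA.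
  by rewrite mulmxK // prj_emb_tr.
have Et : t = emb B *m invmx T *m (emb B)^T by [].
clearbody t.
have PY : prj (Y :|: B) *m prj Y = prj Y :> 'M[F]_n := prj_sub (subsetUl Y B).
have PB : prj (Y :|: B) *m prj B = prj B :> 'M[F]_n := prj_sub (subsetUr Y B).
have YP : prj Y *m prj (Y :|: B) = prj Y :> 'M[F]_n.
  by rewrite prjU // mulmxDr prj_id PYB addr0.
have BP : prj B *m prj (Y :|: B) = prj B :> 'M[F]_n.
  by rewrite prjU // mulmxDr prj_id PBY add0r.
(* [s] is [t] followed by back substitution on [Y], so that [A s] vanishes on the rows [Y] and is
   the identity on [B]. In [N], the term [s A M] cancels what [A M] leaves on the rows [B]. *)
pose s := t - M *m A *m t; pose N := M + s - s *m A *m M.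
have As : prj (Y :|: B) *m A *m s = prj B.
  by rewrite prjU // !mulmxDl /s !mulmxBr !mulmxA PAM subrr add0r St.
have PM : prj (Y :|: B) *m M = M by rewrite -PMl mulmxA PY.
have Ps : prj (Y :|: B) *m s = s.
  by rewrite /s mulmxBr !mulmxA PM -{1}PtB mulmxA PB PtB.
have MP : M *m prj (Y :|: B) = M by rewrite -PMr -mulmxA YP.
have sP : s *m prj (Y :|: B) = s.
  have tP : t *m prj (Y :|: B) = t by rewrite -tPB -mulmxA BP.
  by rewrite /s mulmxBl -!mulmxA tP.
have [||| uYB eN] := @pinv_unique A (Y :|: B) N.
- by rewrite /N mulmxBr mulmxDr !mulmxA PM Ps.
- by rewrite /N mulmxBl mulmxDl -(mulmxA _ M) MP sP.
- rewrite /N mulmxBr mulmxDr !mulmxA As {1}prjU // !mulmxDl PAM.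
  by rewrite addrAC addrK -prjU.
(* The projections onto [B] kill every term that begins or ends with [M]; only [t] survives. *)
split=> //; rewrite eN /N mulmxBr mulmxBl mulmxDr mulmxDl -!mulmxA MPB.
rewrite !mulmx0 subr0 add0r /s mulmxBl mulmxBr !mulmxA PBM !mul0mx subr0.
by rewrite -mulmxA tPB PtB Et.
Qed.

Lemma prj0 : prj set0 = 0.
Proof. by apply/matrixP=> i j; rewrite mxE !mxE inE andbF. Qed.

(** Start of the Schur recursion, where nothing has been eliminated yet. *)
Lemma mxres_set0 A : mxres A set0 set0 \in unitmx /\ pinv A set0 = 0.
Proof. by apply: pinv_unique; rewrite ?prj0 ?mul0mx ?mulmx0. Qed.

Lemma vconcat_restr X Y B (w : 'cV[F]_#|B|) : [disjoint X & Y] ->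
  vconcat (restr X w) (restr Y w) = restr (X :|: Y) w.
Proof.
move=> dXY; rewrite /vconcat !restr_emb -mulmxDr !(mulmxA (emb _)).
by rewrite -!prj_emb_tr -mulmxDl -prjU // mulmxA tr_emb_prj.
Qed.

Lemma tr_emb_disj X Y : [disjoint X & Y] -> (emb X)^T *m emb Y = 0.
Proof.
move=> dXY; rewrite -(tr_emb_prj X) -(prj_emb Y) mulmxA -(mulmxA _ (prj X)).
by rewrite prj_disj // mulmx0 mul0mx.
Qed.

Lemma tr_emb_prj_sub X Y : X \subset Y -> (emb X)^T *m prj Y = (emb X)^T.
Proof.
move=> /subsetP sXY; rewrite tr_emb_mul tr_emb; apply/matrixP=> i j.
by rewrite !mxE sXY ?enum_valP ?andbT.
Qed.

Lemma restr_vconcat X Y Z (a : 'cV[F]_#|X|) (b : 'cV[F]_#|Y|) : Z \subset X :|: Y ->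
  restr Z (vconcat a b) = restr Z a + restr Z b.
Proof.
move=> sZ; rewrite /vconcat restr_emb !(restr_emb (X :|: Y)) -mulmxDr.
rewrite (mulmxA (emb (X :|: Y))) -prj_emb_tr mulmxA tr_emb_prj_sub // mulmxDr.
by rewrite !restr_emb.
Qed.

Lemma restr_disj X Y (b : 'cV[F]_#|Y|) : [disjoint X & Y] -> restr X b = 0.
Proof. by move=> dXY; rewrite restr_emb mulmxA tr_emb_disj ?mul0mx. Qed.

Lemma restr_id X (a : 'cV[F]_#|X|) : restr X a = a.
Proof. by rewrite restr_emb mulmxA emb_tr_emb mul1mx. Qed.

Lemma mxres_mul_restr A X Y Z (w : 'cV[F]_#|Z|) :
  mxres A X Y *m restr Y w = (emb X)^T *m (A *m (prj Y *m (emb Z *m w))).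
Proof. by rewrite restr_emb mxres_emb prj_emb_tr !mulmxA. Qed.

End Embeddings.

(** * Positions of the blocks, and the sets [Xset] and [Bset] *)

Section Decomposition.
Variables (F : fieldType) (n J : nat) (d : decomposition n J).
Variables (A : 'M[F]_n) (f : 'cV[F]_n).
Notation block := (block_seq (Theta d) (V d)).

Lemma block_odd j : block j.*2.+1 = Theta d j.+1.
Proof. by rewrite /block_seq /= odd_double /= doubleK. Qed.

Lemma block_even j : block j.*2 = V d j.
Proof. by rewrite /block_seq odd_double doubleK. Qed.

Lemma Theta0 : Theta d 0 = set0. Proof. exact: Theta_out. Qed.

Lemma V0 : V d 0 = set0. Proof. exact: V_out. Qed.

Lemma VJ : V d J = set0. Proof. by apply: V_out; rewrite ltnn andbF. Qed.

Lemma Xset1 : Xset d 1 = set0.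
Proof. by rewrite /Xset !big_geq // setU0. Qed.

Lemma XsetS j : Xset d j.+2 = Xset d j.+1 :|: Bset d j.+1.
Proof.
rewrite /Xset /Bset /lset /= big_nat_recr //= -!setUA; congr (_ :|: _).
rewrite setUC setUA; congr (_ :|: _).
(* At [j = 0] the set [V d 0] has no counterpart in the union, but it is empty. *)
by case: j => [|j]; [rewrite !big_geq // V0 setU0 | rewrite big_nat_recr].
Qed.

(** [V d j] sits at position [2j] and [Theta d j.+1] at [2j+1], so disjointness and sparsity of
    [Xset] become inequalities between positions. *)
Lemma mem_Xset j i : i \in Xset d j.+1 -> exists2 p, (p < j.*2)%N & i \in block p.
Proof.
elim: j => [|j IHj]; first by rewrite Xset1 inE.
rewrite XsetS doubleS => /setUP[/IHj [p ltpj ip] | /setUP[iV | iT]].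
- by exists p => //; rewrite (leq_trans ltpj) // -addn2 leq_addr.
- by exists j.*2; rewrite ?block_even.
- by exists j.*2.+1; rewrite ?block_odd.
Qed.

Lemma block_disj p q i : i \in block p -> i \in block q -> p = q.
Proof.
move=> ip iq; apply/eqP/negPn/negP=> /(block_disjoint d) /disjointFr/(_ ip).
by rewrite iq.
Qed.

Lemma disjoint_V_Theta j : [disjoint V d j & Theta d j.+1].
Proof. by rewrite -block_even -block_odd block_disjoint // neq_ltn ltnSn. Qed.

Lemma disjoint_Bset_V j : [disjoint Bset d j.+1 & V d j.+1].
Proof.
rewrite /Bset /lset /= -setI_eq0 setIUl setU_eq0 !setI_eq0 -!block_even -block_odd.
by rewrite !block_disjoint // neq_ltn doubleS !ltnS ?leqnn ?leqnSn.
Qed.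

Lemma disjoint_Xset_Bset j : [disjoint Xset d j.+1 & Bset d j.+1].
Proof.
rewrite -setI_eq0; apply/eqP/setP=> i; rewrite in_set0 in_setI.
apply/negP=> /andP[/mem_Xset [p ltpj ip] /setUP].
rewrite /lset /= -block_odd -block_even.
by case=> /(block_disj ip) ep; move: ltpj; rewrite ep ?ltnn // ltnNge leqnSn.
Qed.

(** * Zero blocks of [A] *)

Hypothesis hA : block_tridiagonal d A.

Lemma block_far p q i k : (p.+1 < q)%N || (q.+1 < p)%N ->
  i \in block p -> k \in block q -> A i k = 0.
Proof. by move=> pq ip kq; have /eqP/mxres0P := hA pq; apply. Qed.

(** The positions in [Xset d j.+1] are below [2j], hence at distance at least two from [q]. Among
    the positions from [2j] on, only [2j], that is [V d j], may be coupled to this set. *)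
Lemma Xset_far j q : (j.*2 < q)%N ->
  mxres A (block q) (Xset d j.+1) = 0 /\ mxres A (Xset d j.+1) (block q) = 0.
Proof.
move=> ltjq; split; apply/eqP/mxres0P=> i k.
  move=> iq /mem_Xset [p ltpj kp].
  by apply: block_far iq kp; rewrite orbC (leq_trans _ ltjq).
move=> /mem_Xset [p ltpj ip] kq.
by apply: block_far ip kq; rewrite (leq_trans _ ltjq).
Qed.

Lemma mxres0U (X Y Z : {set 'I_n}) : mxres A X Y = 0 -> mxres A X Z = 0 ->
  mxres A X (Y :|: Z) = 0.
Proof.
move=> /eqP/mxres0P AY /eqP/mxres0P AZ; apply/eqP/mxres0P=> i k iX.
by rewrite inE => /orP[]; [apply: AY | apply: AZ].
Qed.

Lemma mxresU0 (X Y Z : {set 'I_n}) : mxres A X Z = 0 -> mxres A Y Z = 0 ->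
  mxres A (X :|: Y) Z = 0.
Proof.
move=> /eqP/mxres0P AX /eqP/mxres0P AY; apply/eqP/mxres0P=> i k.
by rewrite inE => /orP[]; [apply: AX | apply: AY].
Qed.

Lemma Theta_Xset j : mxres A (Theta d j.+1) (Xset d j.+1) = 0 /\
  mxres A (Xset d j.+1) (Theta d j.+1) = 0.
Proof. by rewrite -block_odd; apply: Xset_far. Qed.

Lemma Bset_Xset j : mxres A (Bset d j.+2) (Xset d j.+1) = 0 /\
  mxres A (Xset d j.+1) (Bset d j.+2) = 0.
Proof.
have [V1 V2] : mxres A (V d j.+1) (Xset d j.+1) = 0 /\
    mxres A (Xset d j.+1) (V d j.+1) = 0.
  by rewrite -block_even; apply: Xset_far; rewrite doubleS.
have [T1 T2] : mxres A (Theta d j.+2) (Xset d j.+1) = 0 /\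
    mxres A (Xset d j.+1) (Theta d j.+2) = 0.
  by rewrite -block_odd; apply: Xset_far; rewrite doubleS ltnS !leqW.
by split; [apply: mxresU0 | apply: mxres0U].
Qed.

Lemma Bset_prevV j : mxres A (Bset d j.+2) (V d j) = 0.
Proof.
by apply: mxresU0; rewrite /lset -!block_even -?block_odd; apply: hA;
  rewrite !doubleS !ltnS ?leqnn ?leqnSn orbT.
Qed.

Lemma Bset_nextTheta j : mxres A (Bset d j.+1) (Theta d j.+2) = 0.
Proof.
by apply: mxresU0; rewrite /lset -?block_even -!block_odd; apply: hA;
  rewrite !doubleS !ltnS ?leqnn ?leqnSn.
Qed.

Lemma V_nextV j : mxres A (V d j) (V d j.+1) = 0.
Proof. by rewrite -!block_even; apply: hA; rewrite doubleS ltnSn. Qed.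

Lemma Theta_prevTheta j : mxres A (Theta d j.+1) (Theta d j) = 0.
Proof.
case: j => [|j]; last by rewrite -!block_odd; apply: hA; rewrite !doubleS ltnSn orbT.
by apply/eqP/mxres0P=> i k _; rewrite Theta0 inE.
Qed.

(** * Closed form of the Schur complements *)

Variable T : forall j, 'M[F]_#|Bset d j|.
Hypothesis hT : schur_complements A T.
Hypothesis hTinv : forall j, (1 <= j <= J)%N -> T j \in unitmx.

(** By induction: [Bset d j.+2] is coupled to [Xset d j.+2] only through [Bset d j.+1], so only that
    diagonal block of the inverse enters, and [schur_block_elimination] identifies it with the
    inverse of [T j.+1]. *)
Lemma schur_closed_form j : (j < J)%N ->
  mxres A (Xset d j.+1) (Xset d j.+1) \in unitmx /\
  T j.+1 = Dblk d A j.+1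
    - (emb F (Bset d j.+1))^T *m A *m pinv A (Xset d j.+1) *m A
      *m emb F (Bset d j.+1).
Proof.
elim: j => [|j IHj] ltjJ.
  have [uX eX] := mxres_set0 A.
  by rewrite Xset1 uX eX !(mulmx0, mul0mx) subr0 hT.1.
have [uX eT] := IHj (ltnW ltjJ).
have uT : T j.+1 \in unitmx := hTinv (ltnW ltjJ : (1 <= j.+1 <= J)%N).
have [uX' eX'] := schur_block_elimination (disjoint_Xset_Bset j) uX eT uT.
rewrite -XsetS in uX' eX'; split=> //.
rewrite hT.2 ?ltjJ //; congr (_ - _).
have [BX XB] := Bset_Xset j.
have dXB := disjoint_Xset_Bset j.
have eBl : (emb F (Bset d j.+2))^T *m A *m prj F (Xset d j.+2)
    = (emb F (Bset d j.+2))^T *m A *m prj F (Bset d j.+1).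
  rewrite XsetS prjU // mulmxDr {1}prj_emb_tr mulmxA -mxres_emb BX mul0mx.
  by rewrite add0r.
have eBr : prj F (Xset d j.+2) *m A *m emb F (Bset d j.+2)
    = prj F (Bset d j.+1) *m A *m emb F (Bset d j.+2).
  rewrite XsetS prjU // !mulmxDl {1}prj_emb_tr -!mulmxA (mulmxA _ A).
  by rewrite -mxres_emb XB mulmx0 add0r.
(* [pinv] absorbs projections onto [Xset d j.+2]; written out, they can be traded for projections
   onto [Bset d j.+1]. *)
transitivity ((emb F (Bset d j.+2))^T *m A *m prj F (Xset d j.+2)
    *m pinv A (Xset d j.+2)
    *m (prj F (Xset d j.+2) *m A *m emb F (Bset d j.+2))).
  rewrite eBl eBr -!mulmxA (mulmxA (pinv _ _)) (mulmxA (prj _ _) (_ *m _)).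
  by rewrite (mulmxA (prj _ _) (pinv _ _)) eX' /Lblk /Ublk !mxres_emb !mulmxA.
rewrite !mulmxA -(mulmxA _ _ (pinv _ _)) prj_pinv.
by rewrite -(mulmxA _ (pinv _ _)) pinv_prj.
Qed.

(** * Subdomain problems as systems with matrix [T] *)

Local Notation e := (emb F).
Local Notation P := (prj F).
Local Notation M j := (pinv A (Xset d j)).

Variables (Aint_l Aext_l : forall j, 'M[F]_#|lset d j|).
Variables (Aint_r Aext_r : forall j, 'M[F]_#|rset d j|).
Hypothesis hsplit : interface_splitting A Aint_l Aext_l Aint_r Aext_r.

Let Ql j : 'M[F]_#|lset d j| := 1%:M.
Let Pl j : 'M[F]_#|lset d j| :=
  Aext_l j - mxres A (lset d j) (Xset d j) *m invmx (mxres A (Xset d j) (Xset d j))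
             *m mxres A (Xset d j) (lset d j).
Let Qr j : 'M[F]_#|rset d j| := 0.
Let Pr j : 'M[F]_#|rset d j| := 1%:M.
Local Notation solves j :=
  (@subdomain_solve F n J d A f Aint_l Aext_l Ql Pl Aint_r Aext_r Qr Pr j).

(* A *m interface_data a b is what the neighbours subtract from f on B_(j+1).
   Its middle term is the Schur correction applied to the left trace of a. *)
Definition interface_data j (a : 'cV[F]_#|Wset d j|) (b : 'cV[F]_#|Wset d j.+2|) :=
  P (Theta d j) *m (e (Wset d j) *m a)
  + M j.+1 *m (A *m (P (V d j) *m (e (Wset d j) *m a)))
  + P (V d j.+1) *m (e (Wset d j.+2) *m b).

Lemma Wset_split j (w : 'cV[F]_#|Wset d j.+1|) :
  e (Wset d j.+1) *m w = P (V d j) *m (e (Wset d j.+1) *m w)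
    + P (Theta d j.+1) *m (e (Wset d j.+1) *m w)
    + P (V d j.+1) *m (e (Wset d j.+1) *m w).
Proof.
rewrite -!mulmxDl -(prjU _ (disjoint_V_Theta j)) -(prjU _ (disjoint_Bset_V j)).
by rewrite mulmxA prj_emb.
Qed.

(** With [Ql = 1] the splitting recombines to the full diagonal block of [A] on [lset], and [Pl]
    adds the Schur correction, which leaves the [Theta] rows unchanged. With [Qr = 0] and [Pr = 1]
    the third equation is a Dirichlet condition. *)
Lemma subdomain_solveP j (a : 'cV[F]_#|Wset d j|) (b : 'cV[F]_#|Wset d j.+2|)
    (w : 'cV[F]_#|Wset d j.+1|) : (j < J)%N ->
  solves j.+1 a b w <->
  T j.+1 *m restr (Bset d j.+1) w
    = cvres (f - A *m interface_data a b) (Bset d j.+1)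
  /\ restr (V d j.+1) w = restr (V d j.+1) b.
Proof.
move=> ltjJ; have [_ eT] := schur_closed_form ltjJ.
have [TX XT] := Theta_Xset j.
(* The range of [M j.+1] lies in [Xset d j.+1], which is not coupled to [Theta d j.+1]; [MA0] is the
   mirror image. *)
have AM0 (x : 'cV_n) : (e (Theta d j.+1))^T *m (A *m (M j.+1 *m x)) = 0.
  by rewrite -prj_pinv -(mulmxA (P _)) mxres0_mul.
have MA0 (x : 'cV_n) : M j.+1 *m (A *m (P (Theta d j.+1) *m x)) = 0.
  rewrite -pinv_prj -(mulmxA _ (P _)) [P (Xset _ _)]prj_emb_tr -(mulmxA (e _)).
  by rewrite mxres0_mul // !mulmx0.
set wh := e _ *m w; set ah := e _ *m a; set bh := e _ *m b.
have Wh := Wset_split w; rewrite -/wh in Wh.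
(* [lhs] represents [T j.+1] times [w] on [Bset d j.+1] as a global vector; its correction term sees
   [w] on [V d j] only. *)
pose lhs := A *m (P (V d j) *m wh) - A *m (M j.+1 *m (A *m (P (V d j) *m wh)))
  + A *m (P (Theta d j.+1) *m wh).
pose rhs := f - A *m interface_data a b.
have eBw : T j.+1 *m restr (Bset d j.+1) w = cvres lhs (Bset d j.+1).
  rewrite eT /Dblk restr_emb mxres_emb -mulmxBl -!(mulmxA (e _)^T) -mulmxBr.
  rewrite -(mulmxA _ (e _) (_ *m _)) (mulmxA (e _) (e _)^T) -prj_emb_tr -/wh.
  rewrite cvres_emb -!(mulmxA (e _)^T); congr (_ *m _).
  rewrite (prjU _ (disjoint_V_Theta j)) mulmxBl -!mulmxA !mulmxDl !mulmxDr.
  by rewrite MA0 mulmx0 addr0 /lhs addrAC.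
have eVw : (Ql j.+1 *m Aint_l j.+1 + Pl j.+1) *m restr (lset d j.+1) w
    + Ql j.+1 *m mxres A (lset d j.+1) (Theta d j.+1) *m restr (Theta d j.+1) w
    = cvres lhs (lset d j.+1).
  rewrite /Ql !mul1mx /Pl addrA -(hsplit _).1 ?ltjJ //.
  rewrite !restr_emb !mxres_emb cvres_emb /lhs mulmxDr mulmxBr.
  by rewrite pinvE !mxres_emb !prj_emb_tr mulmxBl !mulmxA.
have eVr : Ql j.+1 *m (cvres f (lset d j.+1)
        - mxres A (lset d j.+1) (Theta d j) *m restr (Theta d j) a)
      + (Pl j.+1 - Ql j.+1 *m Aext_l j.+1) *m restr (lset d j.+1) a
    = cvres rhs (lset d j.+1).
  rewrite /Ql !mul1mx /Pl (addrAC (Aext_l _)) subrr add0r mulNmx.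
  rewrite !cvres_emb /rhs /interface_data -/ah -/bh.
  rewrite mulmxBr !mulmxDr (mxres0_mul bh (V_nextV j)) addr0 opprD addrA.
  by rewrite !restr_emb pinvE !mxres_emb !prj_emb_tr !mulmxA.
have eTw : mxres A (Theta d j.+1) (Wset d j.+1) *m w
    = cvres lhs (Theta d j.+1)
      + (e (Theta d j.+1))^T *m (A *m (P (V d j.+1) *m wh)).
  rewrite mxres_emb -!mulmxA -/wh [in LHS]Wh cvres_emb /lhs.
  by rewrite !mulmxDr mulmxN AM0 subr0.
have eTr : cvres rhs (Theta d j.+1)
    = cvres f (Theta d j.+1)
      - (e (Theta d j.+1))^T *m (A *m (P (V d j.+1) *m bh)).
  rewrite !cvres_emb /rhs /interface_data -/ah -/bh mulmxBr !mulmxDr AM0 addr0.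
  by rewrite (mxres0_mul ah (Theta_prevTheta j)) add0r.
rewrite /subdomain_solve /= eVw eVr /Qr /Pr !mul0mx add0r add0r subr0 !mul1mx add0r.
(* The [Theta] rows contain [w] on [V d j.+1]; the Dirichlet condition replaces it by [b], which can
   move to the right-hand side. *)
have eP : restr (V d j.+1) w = restr (V d j.+1) b ->
    P (V d j.+1) *m wh = P (V d j.+1) *m bh.
  by rewrite !restr_emb !prj_emb_tr -!mulmxA => ->.
rewrite eBw eTw -/rhs; split=> [[el eTh er] | [/cvresU[el eTh] er]].
  by split=> //; apply/cvresU; split=> //; rewrite eTr -eTh (eP er) addrK.
by split=> //; rewrite eTh eTr (eP er) subrK.
Qed.

(** [T] determines [w] on [Bset], the Dirichlet condition determines it on [V d j.+1], and these
    disjoint sets make up [Wset]. *)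
Lemma subdomain_unisolvent j (a : 'cV[F]_#|Wset d j|) (b : 'cV[F]_#|Wset d j.+2|) :
  (j < J)%N ->
  exists! w : 'cV[F]_#|Wset d j.+1|, solves j.+1 a b w.
Proof.
move=> ltjJ; have uT : T j.+1 \in unitmx := hTinv (ltjJ : (1 <= j.+1 <= J)%N).
have dBV := disjoint_Bset_V j.
pose g := invmx (T j.+1) *m cvres (f - A *m interface_data a b) (Bset d j.+1).
exists (vconcat g (restr (V d j.+1) b)); split.
  apply/(subdomain_solveP _ _ _ ltjJ).
  rewrite !restr_vconcat ?subsetUl ?subsetUr // !restr_id (restr_disj _ dBV) addr0.
  by rewrite restr_disj 1?disjoint_sym // add0r mulKVmx.
move=> w /(subdomain_solveP _ _ _ ltjJ)[ew er].
by rewrite -er /g -ew mulKmx // vconcat_restr // restr_id.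
Qed.

(** The vanishing traces leave only [a] on [Theta d j] in the interface data, which is also all that
    [Lblk] sees. *)
Lemma forward_step j (a : 'cV[F]_#|Wset d j|) (b : 'cV[F]_#|Wset d j.+2|)
    (w : 'cV[F]_#|Wset d j.+1|) (v : 'cV[F]_#|Bset d j.+1|) :
  (j < J)%N -> solves j.+1 a b w ->
  restr (V d j) a = 0 -> restr (V d j.+1) b = 0 ->
  T j.+1 *m v = cvres f (Bset d j.+1) - Lblk d A j *m restr (Bset d j) a ->
  v = restr (Bset d j.+1) w.
Proof.
move=> ltjJ /(subdomain_solveP _ _ _ ltjJ)[ew _] a0 b0 ev.
have uT : T j.+1 \in unitmx := hTinv (ltjJ : (1 <= j.+1 <= J)%N).
rewrite -[LHS](mulKmx uT) -[RHS](mulKmx uT) ev ew; congr (_ *m _).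
rewrite /Lblk mxres_mul_restr; set ah := e _ *m a.
have P0 (k : nat) (c : 'cV[F]_#|Wset d k|) (X : {set 'I_n}) :
    restr X c = 0 -> P X *m (e (Wset d k) *m c) = 0.
  by rewrite restr_emb prj_emb_tr -mulmxA => ->; rewrite mulmx0.
have -> : P (Bset d j) *m ah = P (V d j.-1) *m ah + P (Theta d j) *m ah.
  rewrite -mulmxDl -prjU //; case: (j) => [|i]; last exact: disjoint_V_Theta.
  by rewrite Theta0 -setI_eq0 setI0.
rewrite !cvres_emb /interface_data -/ah (P0 _ a _ a0) (P0 _ b _ b0).
rewrite !mulmx0 !addr0 mulmxBr !mulmxDr.
(* [V d j.-1] is at least two positions before [Bset d j.+1], except at [j = 0], where it is the
   empty [V d 0]. *)
suff -> : (e (Bset d j.+1))^T *m (A *m (P (V d j.-1) *m ah)) = 0.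
  by rewrite add0r.
case: (j) ah => [|i] ah; last by rewrite mxres0_mul // Bset_prevV.
by rewrite V0 prj0 mul0mx !mulmx0.
Qed.

(** [w0] and [w] share their left data, so the two right-hand sides differ only by [A] applied to
    [b] on [V d j.+1]. This is the [Ublk] term, since [Bset d j.+1] is not coupled to
    [Theta d j.+2]. *)
Lemma backward_step j (a : 'cV[F]_#|Wset d j|) (b : 'cV[F]_#|Wset d j.+2|)
    (w0 w : 'cV[F]_#|Wset d j.+1|) (u : 'cV[F]_#|Bset d j.+1|) :
  (j < J)%N ->
  solves j.+1 a 0 w0 ->
  solves j.+1 a b w ->
  T j.+1 *m u = T j.+1 *m restr (Bset d j.+1) w0
    - Ublk d A j.+1 *m restr (Bset d j.+2) b ->
  u = restr (Bset d j.+1) w.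
Proof.
move=> ltjJ /(subdomain_solveP _ _ _ ltjJ)[ew0 _].
move=> /(subdomain_solveP _ _ _ ltjJ)[ew _] eu.
have uT : T j.+1 \in unitmx := hTinv (ltjJ : (1 <= j.+1 <= J)%N).
rewrite -[LHS](mulKmx uT) -[RHS](mulKmx uT) eu ew0 ew; congr (_ *m _).
rewrite /Ublk mxres_mul_restr /Bset (prjU _ (disjoint_V_Theta j.+1)).
rewrite mulmxDl !mulmxDr (mxres0_mul _ (Bset_nextTheta j)) addr0.
rewrite !cvres_emb /interface_data !mulmx0 addr0.
by rewrite -mulmxBr -addrA -opprD -mulmxDr.
Qed.

End Decomposition.

(** * Equality of the iterates *)

Theorem theorem7p1 (R : realType) (n J : nat) (hJ : (0 < J)%N)
  (d : decomposition n J) (A : 'M[complex R]_n) (f : 'cV[complex R]_n)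
  (hA : block_tridiagonal d A)
  (Aint_l Aext_l : forall j : nat, 'M[complex R]_#|lset d j|)
  (Aint_r Aext_r : forall j : nat, 'M[complex R]_#|rset d j|)
  (hsplit : interface_splitting A Aint_l Aext_l Aint_r Aext_r)
  (T : forall j : nat, 'M[complex R]_#|Bset d j|)
  (hT : schur_complements A T)
  (hTinv : forall j : nat, (1 <= j <= J)%N -> T j \in unitmx) :
  let Ql : forall j : nat, 'M[complex R]_#|lset d j| := fun j => 1%:M in
  let Pl : forall j : nat, 'M[complex R]_#|lset d j| := fun j =>
    Aext_l j - mxres A (lset d j) (Xset d j)
               *m invmx (mxres A (Xset d j) (Xset d j))
               *m mxres A (Xset d j) (lset d j) in
  let Qr : forall j : nat, 'M[complex R]_#|rset d j| := fun j => 0 in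
  let Pr : forall j : nat, 'M[complex R]_#|rset d j| := fun j => 1%:M in
  [/\ (* the inverse in Pl exists *)
      forall j : nat, (1 <= j <= J)%N ->
        mxres A (Xset d j) (Xset d j) \in unitmx,
      (* every subdomain problem of DOSM is uniquely solvable *)
      forall (j : nat) (a : 'cV[complex R]_#|Wset d j.-1|)
          (b : 'cV[complex R]_#|Wset d j.+1|), (1 <= j <= J)%N ->
        exists! w : 'cV[complex R]_#|Wset d j|,
          subdomain_solve A f Aint_l Aext_l Ql Pl Aint_r Aext_r Qr Pr a b w
    & (* the iterates of the two algorithms agree *)
      forall (v u : forall j : nat, 'cV[complex R]_#|Bset d j|)
          (uh u1 : forall j : nat, 'cV[complex R]_#|Wset d j|),
        block_LU_solve A f T v u ->
        double_sweep A f Aint_l Aext_l Ql Pl Aint_r Aext_r Qr Pr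
          (fun j => 0) uh u1 ->
        uh J = u1 J ->
        forall j : nat, (1 <= j <= J)%N ->
          v j = vconcat (restr (lset d j) (uh j)) (restr (Theta d j) (uh j)) /\
          u j = vconcat (restr (lset d j) (u1 j)) (restr (Theta d j) (u1 j))].
Proof.
move=> Ql Pl Qr Pr.
split.
- by case=> // j /andP[_ ltjJ]; case: (schur_closed_form hA hT hTinv ltjJ).
- case=> // j a b /andP[_ ltjJ].
  exact: (subdomain_unisolvent f hA hT hTinv hsplit).
move=> v u uh u1 [v1 vS uJ uS] [fwd bwd] uhJ.
(* Every [uh] solves a problem with zero right trace: by the zero initial guess before the last
   subdomain, and in the last one, where [uh J] is [u1 J], because [V d J] is empty. *)
have solve j : (j < J)%N -> exists2 b,
    @subdomain_solve _ n J d A f Aint_l Aext_l Ql Pl Aint_r Aext_r Qr Pr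
      j.+1 (uh j) b (uh j.+1)
    & restr (V d j.+1) b = 0.
  move=> ltjJ; have [ltj1J | leJj] := ltnP j.+1 J.
    by exists 0; [apply: fwd | rewrite /restr mulmx0].
  have ejJ : j.+1 = J by apply/eqP; rewrite eqn_leq ltjJ.
  have uhj : uh j.+1 = u1 j.+1 by rewrite ejJ.
  exists (u1 j.+2); first by rewrite uhj; apply: (bwd j.+1).
  by apply: restr_disj; rewrite ejJ VJ -setI_eq0 set0I.
have vE j : (j < J)%N -> v j.+1 = restr (Bset d j.+1) (uh j.+1).
  elim: j => [|j IHj] ltjJ; have [b sb b0] := solve _ ltjJ.
    (* The first equation of the LU sweep is the general one with [Lblk] applied to a vector over
       the empty [Bset d 0]. *)
    apply: (forward_step hA hT hTinv hsplit ltjJ sb _ b0 _).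
      by apply: restr_disj; rewrite V0 -setI_eq0 set0I.
    rewrite v1 /Lblk mxres_mul_restr /Bset /lset /= V0 Theta0 setU0 prj0.
    by rewrite mul0mx !mulmx0 subr0.
  (* The Dirichlet condition of the previous forward solve gives the zero left trace. *)
  have := fwd j.+1 ltjJ.
  rewrite (subdomain_solveP f hA hT hTinv hsplit) ?(ltnW ltjJ) // => -[_].
  rewrite /restr mulmx0 => a0.
  apply: (forward_step hA hT hTinv hsplit ltjJ sb a0 b0 _).
  by rewrite vS // IHj // ltnW.
(* The backward sweep descends, so the induction is on the distance [k] to the last subdomain. *)
have uE k j : (j + k).+1 = J -> u j.+1 = restr (Bset d j.+1) (u1 j.+1).
  elim: k j => [|k IHk] j ejk.
    rewrite addn0 in ejk; have uv : u j.+1 = v j.+1 by rewrite ejk.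
    have uhj : uh j.+1 = u1 j.+1 by rewrite ejk.
    by rewrite uv vE ?uhj // -ejk.
  have ltj1J : (j.+1 < J)%N by rewrite -ejk !ltnS addnS ltnS leq_addr.
  have ltjJ := ltnW ltj1J.
  (* Forward and backward solves both take [uh j] on the left; the forward one has the zero initial
     guess on the right. *)
  apply: (backward_step hA hT hTinv hsplit ltjJ (fwd j.+1 ltj1J) (bwd j.+1 ltjJ)).
  by rewrite uS // vE // (IHk j.+1) // addSnnS.
case=> // j /andP[_ ltjJ]; rewrite !vconcat_restr; try exact: disjoint_V_Theta.
split; first exact: vE.
by apply: (uE (J - j.+1)%N); rewrite -addSn subnKC.
Qed.
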